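(* Assume that the rival model is linear, $\eta_2(x,\theta_{(2)})=\theta_{(2)}^Tf(x)$ with $\theta_{(2)}\in\Theta_{(2)}=\mathbb{R}^{m_2}$ and $f=(f_1,\ldots,f_{m_2})^T$, that the design space is an interval $\mathcal{X}=I\subset\mathbb{R}$, and that $\{f_1,\ldots,f_{m_2}\}$ is a Chebyshev system on $I$. Then the set $\mathcal{A}$ (defined in the context) has at least $m_2+1$ points. Moreover, assume additionally that $\{f_1,\ldots,f_{m_2},\eta\}$ is also a Chebyshev system on $I$ and that $$\begin{vmatrix} f_1(x_1)&\ldots&f_1(x_{m_2})&0\\ \vdots&\ddots&\vdots&\vdots\\ f_{m_2}(x_1)&\ldots&f_{m_2}(x_{m_2})&0\\ \eta(x_1)&\ldots&\eta(x_{m_2})&1\end{vmatrix}\neq0$$ for all $x_1,\ldots,x_{m_2}\in I$ satisfying $x_1<\cdots<x_{m_2}$. Let $x_1^*<\cdots<x_{m_2+1}^*$ denote $m_2+1$ Chebyshev points of the system $\{f_1,\ldots,f_{m_2},\eta\}$, and define $\xi^*$ as the design which has weights $$w_i^*=\frac{|u_i|}{\sum_{j=1}^{m_2+1}|u_j|}$$ at the points $x_i^*$ ($i=1,\ldots,m_2+1$), where $u=(u_1,\ldots,u_{m_2+1})^T=(X^TX)^{-1}X^Te_{m_2+1}$, $e_{m_2+1}=(0,\ldots,0,1)^T\in\mathbb{R}^{m_2+1}$, and $$X=\begin{pmatrix} f_1(x_1^* )&\cdots&f_1(x_{m_2+1}^* )\\ \vdots&\ddots&\vdots\\ f_{m_2+1}(x_1^*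 )&\cdots&f_{m_2+1}(x_{m_2+1}^* )\end{pmatrix},\qquad f_{m_2+1}:=\eta .$$ Then $\xi^*$ is a $T$-optimal design.
   Context: A design is a probability measure on $I$ with finite support. $\eta,f_1,\ldots,f_{m_2}$ are continuous real-valued functions on $I$, where $\eta$ is the fixed first model (not necessarily linear in parameters; the models need not be nested). For a design $\xi$, $$\Delta(\xi)=\inf_{\theta_{(2)}\in\mathbb{R}^{m_2}}\int_I(\eta(x)-\theta_{(2)}^Tf(x))^2\,d\xi(x),$$ and a design is $T$-optimal if it maximizes $\Delta(\xi)$ over all designs. Standing assumptions: the infimum defining $\Delta(\xi)$ is attained, and a $T$-optimal design exists. The set $\mathcal{A}$: let $\xi^\circ$ be a $T$-optimal design and $\theta_{(2)}^*$ any minimizer over $\mathbb{R}^{m_2}$ of $\theta_{(2)}\mapsto\int_I(\eta(x)-\theta_{(2)}^Tf(x))^2\,d\xi^\circ(x)$; then, with $\|g\|_\infty=\sup_{x\in I}|g(x)|$, $$\mathcal{A}=\{x\in I\mid|\eta(x)-\theta_{(2)}^{*T}f(x)|=\|\eta-\theta_{(2)}^{*T}f\|_\infty\}.$$ A set of $k$ functions $h_1,\ldots,h_k:I\to\mathbb{R}$ is a Chebyshev system on $I$ if there is $\varepsilon\in\{-1,1\}$ such that $\varepsilon\cdot\det(h_i(x_j))_{i,j=1}^k>0$ for all $x_1,\ldots,x_k\in I$ with $x_1<x_2<\cdots<x_k$. With $h=(h_1,\ldots,h_k)^T$, the Chebyshev polynomial of such a system is the function $c^{*T}h$ ($c^*\in\mathbb{R}^k$)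 satisfying (i) $|c^{*T}h(x)|\le1$ for all $x\in I$; (ii) there exist $k$ points $x_1^*<\cdots<x_k^*$ in $I$ such that $c^{*T}h(x_i^* )=(-1)^i$, $i=1,\ldots,k$. Points $x_1^*<\cdots<x_k^*$ as in (ii) are called Chebyshev points (they need not be unique).
   Formalization: I is assumed to have at least two points, and when Δ(ξ°)=0 the set A is assumed not to depend on the chosen minimizer: for f=(1,x), η=0, I=[-1,2], ξ°=δ_0, θ*=(0,1) the set A={2} has only one point. *)

(* Defs.v *)
From HB Require Import structures.
From mathcomp Require Export all_boot all_order all_algebra.
From mathcomp Require Export all_classical all_reals all_analysis.
Set Implicit Arguments.
Unset Strict Implicit.
Unset Printing Implicit Defensive.
Import Order.TTheory GRing.Theory Num.Theory.
Import numFieldNormedType.Exports.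
Local Open Scope classical_set_scope.
Local Open Scope ring_scope.

Section designs.
Variables (R : realType) (I : set R).

Definition is_design (xi : {measure set (measurableTypeR R) -> \bar R}) : Prop :=
  xi setT = 1%E /\
  exists S : set R, [/\ finite_set S, S `<=` I & xi (~` S) = 0%E].

Definition lincomb (k : nat) (c : 'cV[R]_k) (h : 'I_k -> R -> R) (x : R) : R :=
  \sum_(i < k) c i 0 * h i x.

Variables (m : nat) (eta : R -> R) (f : 'I_m -> R -> R).

Definition discrepancy (xi : {measure set (measurableTypeR R) -> \bar R})
    (theta : 'cV[R]_m) : \bar R :=
  (\int[xi]_(x in I) ((eta x - lincomb theta f x) ^+ 2)%:E)%E.

Definition Delta (xi : {measure set (measurableTypeR R) -> \bar R}) : \bar R :=
  ereal_inf (range (discrepancy xi)).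

Definition is_minimizer (xi : {measure set (measurableTypeR R) -> \bar R})
    (theta : 'cV[R]_m) : Prop :=
  forall theta' : 'cV[R]_m, (discrepancy xi theta <= discrepancy xi theta')%E.

Definition T_optimal (xi : {measure set (measurableTypeR R) -> \bar R}) : Prop :=
  is_design xi /\
  forall xi' : {measure set (measurableTypeR R) -> \bar R},
    is_design xi' -> (Delta xi' <= Delta xi)%E.

(* The supremum is taken in the extended reals because I need not be compact;
   the real-valued sup of an unbounded set would be a junk value. *)
Definition sup_norm (g : R -> R) : \bar R :=
  ereal_sup [set (`|g x|)%:E | x in I].

Definition extremal_set (theta : 'cV[R]_m) : set R :=
  [set x | I x /\
    (`|eta x - lincomb theta f x|)%:E =
      sup_norm (fun y => eta y - lincomb theta f y)].

End designs.

Section chebyshev.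
Variables (R : realType) (I : set R) (k : nat) (h : 'I_k -> R -> R).

Definition increasing_points (n : nat) (x : 'I_n -> R) : Prop :=
  (forall i, I (x i)) /\ (forall i j : 'I_n, (i < j)%N -> x i < x j).

Definition chebyshev_system : Prop :=
  exists2 eps : R, eps = 1 \/ eps = -1 &
    forall x : 'I_k -> R, increasing_points x ->
      0 < eps * \det (\matrix_(i < k, j < k) h i (x j)).

(* Ordinals start at 0, so the sign (-1)^i of the 1-based convention becomes
   (-1)^(i+1). *)
Definition alternates_at (c : 'cV[R]_k) (x : 'I_k -> R) : Prop :=
  increasing_points x /\ forall i : 'I_k, lincomb c h (x i) = (-1) ^+ i.+1.

Definition is_chebyshev_polynomial (c : 'cV[R]_k) : Prop :=
  (forall x, I x -> `|lincomb c h x| <= 1) /\ exists x, alternates_at c x.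

Definition chebyshev_points (x : 'I_k -> R) : Prop :=
  exists2 c : 'cV[R]_k, is_chebyshev_polynomial c & alternates_at c x.

End chebyshev.

Section explicit_design.
Variables (R : realType) (m : nat) (f : 'I_m -> R -> R) (eta : R -> R).

(* The family f_1, ..., f_m, eta. *)
Definition extend_family (i : 'I_m.+1) : R -> R :=
  if unlift ord_max i is Some j then f j else eta.

Definition bordered_matrix (x : 'I_m -> R) : 'M[R]_(m + 1) :=
  block_mx (\matrix_(i < m, j < m) f i (x j)) 0
           (\row_(j < m) eta (x j)) 1%:M.

Variable x : 'I_m.+1 -> R.

Definition design_matrix : 'M[R]_m.+1 :=
  \matrix_(i < m.+1, j < m.+1) extend_family i (x j).

Definition u_vec : 'cV[R]_m.+1 :=
  invmx (design_matrix^T *m design_matrix) *m design_matrix^T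
    *m delta_mx ord_max 0.

Definition weight (i : 'I_m.+1) : R :=
  `|u_vec i 0| / \sum_(j < m.+1) `|u_vec j 0|.

Lemma weight_ge0 (i : 'I_m.+1) : 0 <= weight i.
Proof. by rewrite divr_ge0 ?sumr_ge0. Qed.

(* The measure \sum_i weight i * dirac (x i); msum is indexed by nat, hence
   inord. Its total mass is 1 exactly when u_vec != 0, which is part of what
   T_optimal asserts of it. *)
Definition xi_star : {measure set (measurableTypeR R) -> \bar R} :=
  msum (fun n : nat => mscale (NngNum (weight_ge0 (inord n)))
                         (dirac (x (inord n) : measurableTypeR R))) m.+1.

End explicit_design.

(* Main.v *)
Require Import Defs.
From mathcomp Require Import all_boot all_order all_algebra.
From mathcomp Require Import all_classical all_reals all_analysis measurable_realfun.
From mathcomp Require Import ring lra zify.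
Set Implicit Arguments.
Unset Strict Implicit.
Unset Printing Implicit Defensive.
Import Order.TTheory GRing.Theory Num.Theory.
Import numFieldNormedType.Exports.
Local Open Scope classical_set_scope.
Local Open Scope ring_scope.

(** The criterion of a design is the squared distance, in the L2 space of the
design, from [eta] to the span of [f].

Size of the extremal set. Let the optimal design have support [s] and let [r] be
the residual of a minimizer. If [s] has more than [m] points, the least squares
problem is strictly convex, and the equivalence theorem holds
([optimal_residual_le]): the square of [r] is nowhere on [I] larger than the
optimal value, since otherwise a small mass moved to the offending point would
increase the criterion. As the optimal value is a weighted mean of the square of
[r] over [s], equality holds on all of [s] ([support_extremal]), which gives
[m.+1] extremal points. If [s] has at most [m] points, a Chebyshev system
interpolates [eta] on [s] ([interpolation]), so the optimal value is zero. Then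
every design has criterion zero, [eta] lies in the span of [f] on [I]
([vanishing_Delta_span]), and for the parameter that represents it the extremal
set is all of [I]; in this case the extremal set is assumed to be the same for
all minimizers.

Optimality of the explicit design. This is a duality argument, in which [u] is a
certificate. It annihilates [f] and has pairing 1 with [eta] ([u_vec_dual]).
With [U] the sum of the [`|u j|], Cauchy-Schwarz shows that the criterion of the
explicit design is at least [U ^- 2] ([weighted_sqr_ge]). On the other hand the
signs of [u] alternate ([u_vec_alternates]), like the values of the Chebyshev
polynomial at its Chebyshev points, so the coefficient of [eta] in this polynomial
is [U] in absolute value ([alternating_leading_coef]). Divided by this
coefficient, the polynomial becomes a residual that is bounded by [U^-1] on [I],
so no design has a criterion above [U ^- 2]. *)

(** * Designs as finite weighted sums *)

Section FiniteDesigns.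
Variables (R : realType) (I : set R).
Hypothesis mI : measurable (I : set (measurableTypeR R)).

(** The weights are the masses of the atoms. Atoms of mass zero are dropped, so
the points listed are exactly the support; positivity of the weights is what
later makes the quadratic form of a design definite. *)
Lemma integral_design (xi : {measure set (measurableTypeR R) -> \bar R}) :
  is_design I xi ->
  exists s : seq R, exists w : R -> R,
    [/\ uniq s, forall x, x \in s -> I x, forall x, x \in s -> 0 < w x,
        \sum_(x <- s) w x = 1 &
        forall g : R -> R, measurable_fun I g -> (forall x, 0 <= g x) ->
          (\int[xi]_(x in I) (g x)%:E)%E = (\sum_(x <- s) w x * g x)%:E].
Proof.
move=> [xi1 [S [/finite_seqP[t tE] SI xi0]]].
pose s0 := undup t.
have s0E : S = \big[setU/set0]_(x <- s0) [set x].
  rewrite tE; apply/seteqP; split => [x /= xt|x].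
    by rewrite -bigcup_seq; exists x => //=; rewrite mem_undup.
  by rewrite -bigcup_seq => -[y /= yt ->]; rewrite -mem_undup.
have us0 : uniq s0 by exact: undup_uniq.
have mS : measurable (S : set (measurableTypeR R)).
  by rewrite s0E; apply: bigsetU_measurable => x _; exact: measurable_set1.
have finx x : xi [set x] \is a fin_num.
  rewrite ge0_fin_numE//; apply: (@le_lt_trans _ _ (xi setT)).
    by rewrite le_measure ?inE//; exact: measurable_set1.
  by rewrite xi1 ltry.
pose w x := fine (xi [set x]).
have w0 x : 0 <= w x by exact: fine_ge0.
have intg (g : R -> R) : measurable_fun I g -> (forall x, 0 <= g x) ->
    (\int[xi]_(x in I) (g x)%:E)%E = (\sum_(x <- s0) w x * g x)%:E.
  move=> mg g0.
  have mgE : measurable_fun (I : set (measurableTypeR R))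
      (fun x : measurableTypeR R => (g x)%:E).
    exact/measurable_EFinP.
  rewrite (@ge0_negligible_integral _ _ _ xi I (~` S))//; last 2 first.
    exact: measurableC.
    by move=> x _; rewrite lee_fin.
  have -> : I `\` ~` S = \big[setU/set0]_(x <- s0) [set x].
    by rewrite -s0E setDE setCK; exact/setIidr.
  rewrite (@ge0_integral_bigsetU _ _ _ xi)//; last 3 first.
  - by move=> i j /= _ _ [x [/= -> ->]].
  - by rewrite -s0E; apply: (measurable_funS mI SI).
  - by move=> x _; rewrite lee_fin.
  rewrite -sumEFin; apply: eq_bigr => x _.
  rewrite (eq_integral (cst (g x)%:E)); last by move=> y; rewrite inE => ->.
  rewrite integral_cst; last exact: measurable_set1.
  by rewrite mulrC EFinM fineK.
have pos (g : R -> R) :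
   \sum_(x <- [seq x <- s0 | 0 < w x]) w x * g x = \sum_(x <- s0) w x * g x.
  rewrite big_filter [RHS](bigID (fun x => 0 < w x))/= [X in _ + X]big1 ?addr0//.
  by move=> x; rewrite -leNgt => wx; rewrite (@le_anti _ _ (w x) 0) ?mul0r// wx w0.
exists [seq x <- s0 | 0 < w x], w; split.
- exact: filter_uniq.
- by move=> x; rewrite mem_filter mem_undup => /andP[_ xt]; apply: SI; rewrite tE.
- by move=> x; rewrite mem_filter => /andP[].
- have := intg (cst 1) (measurable_cst _) (fun=> ler01).
  rewrite -pos (eq_integral (cst 1%E))// integral_cst// mul1e => /eqP.
  have -> : xi I = 1%E.
    rewrite -xi1; apply/eqP; rewrite eq_le le_measure ?inE//=.
    rewrite -(setUv S) measureU ?setICr//; last exact: measurableC.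
    by rewrite [X in (_ + X)%E]xi0 adde0 le_measure ?inE.
  by rewrite eqe => /eqP ->; apply: eq_bigr => x _; rewrite mulr1.
- by move=> g mg g0; rewrite intg// pos.
Qed.

(** The shape is the one of [xi_star], so that the explicit design of the theorem
is an instance up to conversion. *)
Definition discrete_measure (n : nat) (p : 'I_n.+1 -> R)
    (w : 'I_n.+1 -> {nonneg R}) : {measure set (measurableTypeR R) -> \bar R} :=
  msum (fun k : nat => mscale (w (inord k))
                         (dirac (p (inord k) : measurableTypeR R))) n.+1.

Lemma discrete_measure_is_design n (p : 'I_n.+1 -> R) w :
  (forall i, I (p i)) -> \sum_i (w i)%:num = 1 ->
  is_design I (discrete_measure p w).
Proof.
move=> pI w1.
have E (A : set R) : discrete_measure p w A =
    (\sum_(i < n.+1) (w i)%:num%:E * \d_(p i) A)%E.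
  by rewrite /discrete_measure/= /msum; apply: eq_bigr => i _;
     rewrite /mscale/= inord_val.
split.
  rewrite E -[RHS]/((1%R)%:E) -w1 -sumEFin; apply: eq_bigr => i _.
  by rewrite diracT mule1.
exists (range p); split.
- exact: finite_image.
- by move=> _ [i _ <-].
- rewrite E big1// => i _; rewrite diracE memNset ?mule0//=.
  by apply; exists i.
Qed.

Lemma integral_discrete_measure n (p : 'I_n.+1 -> R) w (g : R -> R) :
  (forall i, I (p i)) -> measurable_fun I g -> (forall x, 0 <= g x) ->
  (\int[discrete_measure p w]_(x in I) (g x)%:E)%E =
  (\sum_i (w i)%:num * g (p i))%:E.
Proof.
move=> pI mg g0.
have mgE : measurable_fun (I : set (measurableTypeR R))
      (fun x : measurableTypeR R => (g x)%:E).
  exact/measurable_EFinP.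
rewrite ge0_integral_measure_sum//; last by move=> x _; rewrite lee_fin.
rewrite -sumEFin; apply: eq_bigr => i _.
rewrite (@ge0_integral_mscale _ _ _ _ _ mI)//; last first.
  by move=> x _; rewrite lee_fin.
by rewrite integral_dirac// diracE mem_set// mul1e inord_val EFinM.
Qed.

Lemma measurable_sq_residual m (eta : R -> R) (f : 'I_m -> R -> R) theta :
  {within I, continuous eta} -> (forall i, {within I, continuous (f i)}) ->
  measurable_fun I (fun x => (eta x - lincomb theta f x) ^+ 2).
Proof.
move=> ceta cf; apply: measurable_funX; apply: measurable_funB.
  exact: (subspace_continuous_measurable_fun mI).
apply: (@measurable_sum _ _ _ I _ _ (fun i x => theta i 0 * f i x)) => i.
apply: measurable_funM => //.
by apply: (subspace_continuous_measurable_fun mI); exact: cf.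
Qed.

End FiniteDesigns.

(** The weight [t] of [x0] is kept apart from the weights of [s], and [x0] may
already occur in [s]: this covers both a mixture of a given design with a point
mass and a uniform design on given points. *)
Lemma finite_design_exists (R : realType) (I : set R)
    (mI : measurable (I : set (measurableTypeR R)))
    (s : seq R) (w : R -> R) (x0 t : R) :
  (forall x, x \in s -> I x) -> I x0 -> (forall x, x \in s -> 0 <= w x) ->
  0 <= t -> \sum_(x <- s) w x + t = 1 ->
  exists2 xi : {measure set (measurableTypeR R) -> \bar R}, is_design I xi &
    forall g : R -> R, measurable_fun I g -> (forall x, 0 <= g x) ->
      (\int[xi]_(x in I) (g x)%:E)%E = (\sum_(x <- s) w x * g x + t * g x0)%:E.
Proof.
move=> sI Ix0 w_ge0 t0 w1.
(* The default value of nth puts x0 at the last index. *)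
pose p (i : 'I_(size s).+1) : R := nth x0 s i.
pose wt (i : 'I_(size s).+1) : R := if (i < size s)%N then w (p i) else t.
have wt0 i : 0 <= wt i.
  by rewrite /wt; case: ifP => // si; rewrite w_ge0// mem_nth.
have pI i : I (p i).
  rewrite /p; have [si|si] := ltnP i (size s); last by rewrite nth_default.
  by apply: sI; exact: mem_nth.
have sumE (g : R -> R) :
    \sum_i wt i * g (p i) = \sum_(x <- s) w x * g x + t * g x0.
  rewrite big_ord_recr/= /wt /p ltnn nth_default// (big_nth x0) big_mkord.
  by congr (_ + _); apply: eq_bigr => i _ /=; rewrite ltn_ord.
exists (discrete_measure p (fun i => NngNum (wt0 i))).
  apply: discrete_measure_is_design => //.
  rewrite -w1 -[t in RHS]mulr1.
  under [in RHS]eq_bigr do rewrite -[w _]mulr1.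
  by rewrite -(sumE (fun=> 1)); apply: eq_bigr => i _; rewrite mulr1.
by move=> g mg g0; rewrite integral_discrete_measure// -sumE.
Qed.

(** * Interpolation by Chebyshev systems *)

Section LinearCombinations.
Variables (R : realType) (m : nat) (f : 'I_m -> R -> R).

Lemma lincombD c d x : lincomb (c + d) f x = lincomb c f x + lincomb d f x.
Proof. by rewrite -big_split/=; apply: eq_bigr => i _; rewrite mxE mulrDl. Qed.

Lemma lincombZ a c x : lincomb (a *: c) f x = a * lincomb c f x.
Proof. by rewrite mulr_sumr; apply: eq_bigr => i _; rewrite mxE mulrA. Qed.

Lemma lincombB c d x : lincomb (c - d) f x = lincomb c f x - lincomb d f x.
Proof. by rewrite -scaleN1r lincombD lincombZ mulN1r. Qed.

End LinearCombinations.

Section Interpolation.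
Variables (R : realType) (I : set R).
Hypothesis HI : is_interval I.
Hypothesis I_nondegenerate : exists a b : R, [/\ I a, I b & a < b].

(** Moving the right end down to each point of [s] that lies in the interval
leaves an interval that avoids [s]. *)
Lemma exists_between_notin (s : seq R) (a b : R) :
  a < b -> exists2 x, a < x < b & x \notin s.
Proof.
elim: s b => [|y s IHs] b ab.
  by exists ((a + b) / 2); rewrite ?midf_lt.
have [/andP[ay yb]|yN] := boolP (a < y < b).
  have [x /andP[ax xy] xs] := IHs y ay.
  by exists x; rewrite ?ax ?(lt_trans xy)// inE negb_or xs lt_eqF.
have [x axb xs] := IHs b ab; exists x => //.
by rewrite inE negb_or xs andbT; apply: contraNneq yN => <-.
Qed.

Lemma extend_points (s : seq R) (n : nat) :
  uniq s -> (forall x, x \in s -> I x) -> (size s <= n)%N ->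
  exists s', [/\ uniq s', forall x, x \in s' -> I x, size s' = n &
                 {subset s <= s'}].
Proof.
move=> + + /subnKC; move: (n - size s)%N => k.
elim: k s => [|k IHk] s us sI.
  by rewrite addn0 => <-; exists s; split => // x.
have [a [b [Ia Ib ab]]] := I_nondegenerate.
have [x /andP[ax xb] xs] := exists_between_notin s ab.
have Ix : I x by apply: (HI Ia Ib); rewrite (ltW ax) (ltW xb).
rewrite addnS -addSn => sk.
have [||//|s' [us' s'I szs' ss']] := IHk (x :: s).
- by rewrite /= xs us.
- by move=> y; rewrite inE => /predU1P[->//|]; exact: sI.
by exists s'; split=> // y ys; apply: ss'; rewrite inE ys orbT.
Qed.

Lemma exists_points (n : nat) :
  exists s, [/\ uniq s, forall x, x \in s -> I x & size s = n].
Proof.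
have noI x : x \in [::] -> I x by [].
by have [s [us sI szs _]] := @extend_points [::] n isT noI isT; exists s.
Qed.

Variables (m : nat) (f : 'I_m -> R -> R).
Hypothesis f_cheb : chebyshev_system I f.

(* The determinant condition of a Chebyshev system speaks of increasing points
only, so the points are sorted first. *)
Let nodes (s : seq R) : seq R := sort <=%O s.
Let collocation (s : seq R) : 'M[R]_m := \matrix_(i, j) f i (nodes s)`_j.

Let collocation_unit (s : seq R) :
  uniq s -> (forall x, x \in s -> I x) -> size s = m ->
  collocation s \in unitmx.
Proof.
move=> us sI sm; rewrite unitmxE unitfE; have [eps _ det_gt0] := f_cheb.
have szn : size (nodes s) = m by rewrite size_sort.
have := det_gt0 (fun j => (nodes s)`_j); rewrite /collocation.
case: eqP => // -> H; have : (0 : R) < eps * 0; last by rewrite mulr0 ltxx.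
apply: H; split=> [j|i j ij].
  by apply: sI; rewrite -(mem_sort <=%O) mem_nth// szn.
by rewrite lt_sorted_ltn_nth ?sort_lt_sorted// inE szn.
Qed.

(** A Chebyshev system of [m] functions interpolates at any [m] points; fewer
points are first completed to [m] points of the interval. *)
Lemma interpolation (s : seq R) (v : R -> R) :
  uniq s -> (forall x, x \in s -> I x) -> (size s <= m)%N ->
  exists theta : 'cV[R]_m, forall x, x \in s -> lincomb theta f x = v x.
Proof.
move=> us sI sm.
have [s' [us' s'I sm' ss']] := extend_points us sI sm.
pose r : 'rV[R]_m := \row_j v (nodes s')`_j.
exists (r *m invmx (collocation s'))^T => x /ss'.
rewrite -(mem_sort <=%O) -/(nodes s') => /(nthP 0)[k]; rewrite size_sort sm'.
move=> km <-; pose j := Ordinal km.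
have := congr1 (fun M : 'rV_m => M 0 j) (mulmxKV (collocation_unit us' s'I sm') r).
rewrite mxE [X in _ = X -> _]mxE => <-.
by apply: eq_bigr => i _; rewrite [collocation _ _ _]mxE; congr (_ * _); exact: mxE.
Qed.

(** The dual of interpolation: since the matrix at [m] points is invertible,
evaluation at any further point is a combination of the evaluations at these
points. It bounds a member of the span anywhere by its values on a support. *)
Lemma evaluation_from_nodes (s : seq R) (x0 : R) :
  uniq s -> (forall x, x \in s -> I x) -> size s = m ->
  exists a : R -> R, forall d : 'cV[R]_m,
    lincomb d f x0 = \sum_(x <- s) a x * lincomb d f x.
Proof.
move=> us sI sm.
pose c : 'cV[R]_m := invmx (collocation s) *m \col_i f i x0.
have cE : collocation s *m c = \col_i f i x0.
  by rewrite mulKVmx ?collocation_unit.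
pose ci (k : nat) : R := if insub k is Some j then c j 0 else 0.
exists (fun x => ci (index x (nodes s))) => d.
have szn : size (nodes s) = m by rewrite size_sort.
have un : uniq (nodes s) by rewrite sort_uniq.
rewrite [RHS](perm_big (nodes s)) ?(perm_sym s) ?perm_sort//= (big_nth 0) szn big_mkord.
transitivity (\sum_(j < m) c j 0 * lincomb d f (nodes s)`_j); last first.
  by apply: eq_bigr => j _; rewrite index_uniq ?szn// /ci valK.
under [RHS]eq_bigr do rewrite mulr_sumr.
rewrite exchange_big/=; apply: eq_bigr => i _.
transitivity (d i 0 * (collocation s *m c) i 0); first by rewrite cE mxE.
by rewrite mxE mulr_sumr; apply: eq_bigr => j _; rewrite mxE; ring.
Qed.

End Interpolation.

(** * Quadratic inequalities *)

(** A linear form in the values at finitely many points is controlled by any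
positive definite diagonal form in these values. *)
Lemma sqr_sum_le (R : realType) (s : seq R) (a w : R -> R) :
  (forall x, x \in s -> 0 < w x) ->
  exists2 C : R, 0 < C &
    forall l : R -> R,
      (\sum_(x <- s) a x * l x) ^+ 2 <= C * \sum_(x <- s) w x * l x ^+ 2.
Proof.
elim: s => [|y s IHs] w_gt0.
  by exists 1 => // l; rewrite !big_nil expr0n/= mulr0.
have wy : 0 < w y by apply: w_gt0; rewrite mem_head.
have [|C C0 CE] := IHs; first by move=> x xs; rewrite w_gt0// inE xs orbT.
have K0 : 0 <= 2 * a y ^+ 2 / w y by rewrite divr_ge0 ?(ltW wy)// mulr_ge0 ?sqr_ge0.
exists (2 * a y ^+ 2 / w y + 2 * C); first by lra.
move=> l; have := CE l; rewrite !big_cons.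
set S := \sum_(x <- s) _; set Q := \sum_(x <- s) _ => SQ.
have Q0 : 0 <= Q.
  by have := le_trans (sqr_ge0 S) SQ; rewrite pmulr_rge0.
have wl : 0 <= w y * l y ^+ 2 by rewrite mulr_ge0 ?(ltW wy) ?sqr_ge0.
have al : (2 * a y ^+ 2 / w y) * (w y * l y ^+ 2) = 2 * (a y * l y) ^+ 2.
  by field; rewrite gt_eqF.
have : (a y * l y + S) ^+ 2 <= 2 * (a y * l y) ^+ 2 + 2 * S ^+ 2.
  by have := sqr_ge0 (a y * l y - S); nra.
have := mulr_ge0 K0 Q0; have := mulr_ge0 (ltW C0) wl.
rewrite -al; move: (2 * _ / _) (w y * _ ^+ 2) => K W; lra.
Qed.

(** The first-order effect of mixing with a point mass. [D0] is the optimal value,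
[V] the value at a perturbed parameter, [Q] the quadratic form of the
perturbation, [r0] the residual at the new point and [b] the change of this
residual. The loss [- 2 t r0 b] is linear in [b], but [b ^+ 2 / (4 * C)] is gained
from [Q]; after completing the square only a term of order [t ^+ 2] is lost. *)
Lemma mixture_ge (R : realType) (D0 V Q b C r0 t : R) :
  0 < C -> 0 < t <= 2^-1 -> D0 + Q / 2 <= V -> b ^+ 2 <= C * Q ->
  (1 - t) * D0 + t * r0 ^+ 2 - 4 * C * t ^+ 2 * r0 ^+ 2
  <= (1 - t) * V + t * (r0 - b) ^+ 2.
Proof.
move=> C0 /andP[t0 t2] VD bQ.
have Q0 : 0 <= Q by have := le_trans (sqr_ge0 b) bQ; rewrite pmulr_rge0.
have V1 : (1 - t) * (D0 + Q / 2) <= (1 - t) * V.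
  by rewrite ler_wpM2l//; lra.
have Q1 : 0 <= (2^-1 - t) * Q by rewrite mulr_ge0// subr_ge0.
have Q2 : b ^+ 2 / (4 * C) <= Q / 4.
  by rewrite ler_pdivrMr ?mulr_gt0//; lra.
have := divr_ge0 (sqr_ge0 (b - 4 * C * t * r0)) (mulr_ge0 (ler0n R 4) (ltW C0)).
have -> : (b - 4 * C * t * r0) ^+ 2 / (4 * C) =
   b ^+ 2 / (4 * C) - 2 * t * r0 * b + 4 * C * t ^+ 2 * r0 ^+ 2.
  by field; rewrite gt_eqF.
have := mulr_ge0 (ltW t0) (sqr_ge0 b); lra.
Qed.

Lemma sum_norm_gt0 (R : realType) (n : nat) (u r : 'I_n -> R) :
  \sum_j u j * r j = 1 -> 0 < \sum_j `|u j|.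
Proof.
move=> ur1; rewrite lt0r sumr_ge0// andbT; apply/eqP => /eqP.
rewrite psumr_eq0// => /allP u0.
suff : (1 : R) = 0 by move/eqP; rewrite oner_eq0.
rewrite -ur1 big1// => j _; have /= := u0 j (mem_index_enum j).
by rewrite normr_eq0 => /eqP ->; rewrite mul0r.
Qed.

(** Cauchy-Schwarz for the weights [`|u j| / U]. It is obtained termwise from the
tangent of the square at the equality case [r j = Num.sg (u j) / U]. *)
Lemma weighted_sqr_ge (R : realType) (n : nat) (u r : 'I_n -> R) :
  let U := \sum_j `|u j| in
  \sum_j u j * r j = 1 -> U ^- 2 <= \sum_j `|u j| / U * r j ^+ 2.
Proof.
move=> U ur1.
have U0 : 0 < U := sum_norm_gt0 ur1.
have -> : U ^- 2 = \sum_j (2 * U ^- 2 * (u j * r j) - U ^- 3 * `|u j|).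
  by rewrite sumrB -!mulr_sumr ur1 -/U; field; rewrite gt_eqF.
apply: ler_sum => j _; rewrite -subr_ge0.
have [u0|u0] := leP 0 (u j).
  rewrite ger0_norm//.
  rewrite (_ : _ - _ = u j / U * (r j - U^-1) ^+ 2); last by field; rewrite gt_eqF.
  by rewrite mulr_ge0 ?sqr_ge0// divr_ge0// ltW.
rewrite ltr0_norm//.
rewrite (_ : _ - _ = - u j / U * (r j + U^-1) ^+ 2); last by field; rewrite gt_eqF.
by rewrite mulr_ge0 ?sqr_ge0// divr_ge0 ?oppr_ge0// ltW.
Qed.

(** * The equivalence theorem and the degenerate case *)

Section Optimality.
Variables (R : realType) (I : set R) (m : nat).
Variables (eta : R -> R) (f : 'I_m -> R -> R).
Hypothesis HI : is_interval I.
Hypothesis I_nondegenerate : exists a b : R, [/\ I a, I b & a < b].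
Hypothesis eta_continuous : {within I, continuous eta}.
Hypothesis f_continuous : forall i : 'I_m, {within I, continuous (f i)}.
Hypothesis f_cheb : chebyshev_system I f.

Let residual (theta : 'cV[R]_m) (x : R) : R := eta x - lincomb theta f x.

Let mI : measurable (I : set (measurableTypeR R)).
Proof. exact: is_interval_measurable. Qed.

Let mresidual theta : measurable_fun I (fun x => residual theta x ^+ 2).
Proof. exact: measurable_sq_residual. Qed.

Lemma Delta_ge (xi : {measure set (measurableTypeR R) -> \bar R}) (K : \bar R) :
  (forall theta, K <= discrepancy I eta f xi theta)%E ->
  (K <= Delta I eta f xi)%E.
Proof. by move=> KP; apply/ereal_infP => _ [theta _ <-]. Qed.

Lemma Delta_le (xi : {measure set (measurableTypeR R) -> \bar R}) theta :
  (Delta I eta f xi <= discrepancy I eta f xi theta)%E.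
Proof. by apply: ge_ereal_inf; exists (discrepancy I eta f xi theta) => //; exists theta. Qed.

Lemma Delta_ge0 (xi : {measure set (measurableTypeR R) -> \bar R}) :
  (0 <= Delta I eta f xi)%E.
Proof.
apply: Delta_ge => theta; apply: integral_ge0 => x _.
by rewrite lee_fin sqr_ge0.
Qed.

(** Strong convexity of the least squares criterion, with the constant that
comes from comparing the minimum with the value at the midpoint of the two
parameters by the parallelogram identity. *)
Lemma midpoint_gap (s : seq R) (w : R -> R) (theta0 theta : 'cV[R]_m) :
  (forall theta', \sum_(x <- s) w x * residual theta0 x ^+ 2 <=
                  \sum_(x <- s) w x * residual theta' x ^+ 2) ->
  \sum_(x <- s) w x * residual theta0 x ^+ 2
    + (\sum_(x <- s) w x * lincomb (theta - theta0) f x ^+ 2) / 2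
  <= \sum_(x <- s) w x * residual theta x ^+ 2.
Proof.
move=> min0; have := min0 (2^-1 *: (theta0 + theta)).
set A := \sum_(x <- s) _; set B := \sum_(x <- s) _; set Q := \sum_(x <- s) _.
set V := \sum_(x <- s) _.
suff -> : B = A / 2 + V / 2 - Q / 4 by lra.
rewrite /A /B /V /Q !mulr_suml -big_split -sumrB/=.
apply: eq_bigr => x _.
by rewrite /residual lincombZ lincombD lincombB; field.
Qed.

(** The equivalence theorem. If the squared residual at [x0] were larger than the
optimal value, then moving a small mass [t] to [x0] would raise the criterion at
first order in [t], and the re-optimised parameter can recover only a term of
order [t ^+ 2], because the design has at least [m] support points and its
quadratic form therefore controls the value at [x0] of every member of the
span. *)
Lemma optimal_residual_le (xi0 : {measure set (measurableTypeR R) -> \bar R})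
    (theta0 : 'cV[R]_m) (s : seq R) (w : R -> R) :
  T_optimal I eta f xi0 -> is_minimizer I eta f xi0 theta0 ->
  uniq s -> (forall x, x \in s -> I x) -> (forall x, x \in s -> 0 < w x) ->
  \sum_(x <- s) w x = 1 ->
  (forall theta, discrepancy I eta f xi0 theta =
                 (\sum_(x <- s) w x * residual theta x ^+ 2)%:E) ->
  (m <= size s)%N ->
  forall x0, I x0 ->
    residual theta0 x0 ^+ 2 <= \sum_(x <- s) w x * residual theta0 x ^+ 2.
Proof.
move=> [_ opt] min0 us sI w_gt0 w1 discE ms x0 Ix0.
set D0 := \sum_(x <- s) _; set r0 := residual theta0 x0.
have ts x : x \in take m s -> x \in s by exact: mem_take.
have [a aE] := evaluation_from_nodes f_cheb x0 (take_uniq m us)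
  (fun x xt => sI x (ts x xt)) (size_takel ms).
have [C C0 CE] := sqr_sum_le a (fun x xt => w_gt0 x (ts x xt)).
have w_ge0 x : x \in s -> 0 <= w x by move/w_gt0/ltW.
have evalQ d : lincomb d f x0 ^+ 2 <= C * \sum_(x <- s) w x * lincomb d f x ^+ 2.
  rewrite aE (le_trans (CE _))// ler_pM2l// -[in leRHS](cat_take_drop m s).
  rewrite big_cat/= lerDl big_seq sumr_ge0// => x /mem_drop xs.
  by rewrite mulr_ge0 ?sqr_ge0 ?w_ge0.
have gain t : 0 < t <= 2^-1 -> r0 ^+ 2 - D0 <= 4 * C * t * r0 ^+ 2.
  move=> /andP[t0 t2].
  have [|||||xi xi_design xiE] :=
    @finite_design_exists _ _ mI s (fun x => (1 - t) * w x) x0 t => //.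
  - by move=> x /w_ge0 wx; rewrite mulr_ge0//; lra.
  - exact: ltW.
  - by rewrite -mulr_sumr w1; ring.
  suff : (((1 - t) * D0 + t * r0 ^+ 2 - 4 * C * t ^+ 2 * r0 ^+ 2)%:E <= D0%:E)%E.
    by rewrite lee_fin => le0; rewrite -(ler_pM2l t0); lra.
  rewrite -discE; apply: le_trans (Delta_le xi0 theta0).
  apply: le_trans (opt _ xi_design); apply: Delta_ge => theta.
  rewrite /discrepancy xiE; [|exact: mresidual|by move=> x; exact: sqr_ge0].
  rewrite lee_fin.
  under eq_bigr do rewrite -mulrA; rewrite -mulr_sumr.
  have := evalQ (theta - theta0).
  rewrite -/(residual theta x0).
  have -> : residual theta x0 = r0 - lincomb (theta - theta0) f x0.
    by rewrite /r0 /residual lincombB; ring.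
  apply: mixture_ge => //; first by rewrite t0.
  by apply: midpoint_gap => theta'; rewrite -lee_fin -!discE; exact: min0.
rewrite leNgt; apply/negP => lt0.
(* With t = (r0 ^+ 2 - D0) / (2 * M) the bound of gain falls below
r0 ^+ 2 - D0, since M exceeds 2 * C * r0 ^+ 2; moreover M >= r0 ^+ 2 - D0 keeps
t at most 1/2. *)
pose M := (r0 ^+ 2 - D0) + 8 * C * r0 ^+ 2.
have CR : 0 <= C * r0 ^+ 2 by rewrite mulr_ge0 ?sqr_ge0// ltW.
have M0 : 0 < M by rewrite /M; lra.
have t_ok : 0 < (r0 ^+ 2 - D0) / (2 * M) <= 2^-1.
  rewrite divr_gt0 ?subr_gt0 ?mulr_gt0//=.
  by rewrite ler_pdivrMr ?mulr_gt0// /M; lra.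
have := gain _ t_ok; apply/negP; rewrite -ltNge.
rewrite [ltLHS](_ : _ = (r0 ^+ 2 - D0) * (4 * C * r0 ^+ 2 / (2 * M))); last by ring.
rewrite gtr_pMr ?subr_gt0// ltr_pdivrMr ?mulr_gt0// /M; lra.
Qed.

(** The weighted mean of the squared residual is also an upper bound of it, hence
the squared residual equals this mean at every point of positive weight. *)
Lemma support_extremal (theta : 'cV[R]_m) (s : seq R) (w : R -> R) :
  (forall x, x \in s -> I x) -> (forall x, x \in s -> 0 < w x) ->
  \sum_(x <- s) w x = 1 ->
  (forall x0, I x0 ->
     residual theta x0 ^+ 2 <= \sum_(x <- s) w x * residual theta x ^+ 2) ->
  [set` s] `<=` extremal_set I eta f theta.
Proof.
move=> sI w_gt0 w1; set D0 := \sum_(x <- s) _ => le_D0.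
have sum0 : \sum_(x <- s | x \in s) w x * (D0 - residual theta x ^+ 2) = 0.
  rewrite -big_seq; under eq_bigr do rewrite mulrBr.
  by rewrite sumrB -mulr_suml w1 mul1r subrr.
have eq_D0 x : x \in s -> residual theta x ^+ 2 = D0.
  move=> xs; move/eqP: sum0; rewrite psumr_eq0.
    move=> /allP/(_ x xs); rewrite xs/= mulf_eq0 gt_eqF ?w_gt0//= subr_eq0.
    by move=> /eqP.
  move=> y ys; apply: mulr_ge0; first by apply: ltW; exact: w_gt0.
  by rewrite subr_ge0 le_D0//; exact: sI.
move=> x /= xs; split; first exact: sI.
apply/eqP; rewrite eq_le; apply/andP; split.
  apply: le_ereal_sup_tmp; exists `|residual theta x|%:E => //.
  by exists x => //; exact: sI.
apply/ereal_supP => _ [y Iy <-]; rewrite lee_fin.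
rewrite -ler_sqr ?nnegrE// !real_normK ?num_real// -/(residual theta x)
  (eq_D0 x xs); exact: le_D0.
Qed.

(** Interpolate [eta] at [m] points. For any further point, a uniform design on
all [m.+1] points has criterion zero, so a single member of the span agrees with
[eta] at these [m.+1] points; its values at the first [m] points determine its
value at the last one. *)
Lemma vanishing_Delta_span
    (Hattained : forall xi : {measure set (measurableTypeR R) -> \bar R},
       is_design I xi ->
       exists theta, discrepancy I eta f xi theta = Delta I eta f xi) :
  (forall xi : {measure set (measurableTypeR R) -> \bar R},
     is_design I xi -> (Delta I eta f xi <= 0)%E) ->
  exists theta, forall x, I x -> residual theta x = 0.
Proof.
move=> Delta0.
have [q [uq qI szq]] := exists_points HI I_nondegenerate m.
have [theta0 th0] : exists theta : 'cV[R]_m,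
    forall x, x \in q -> lincomb theta f x = eta x.
  by apply: (interpolation HI I_nondegenerate f_cheb) => //; rewrite szq.
exists theta0 => x0 Ix0; apply/eqP; rewrite subr_eq0; apply/eqP.
pose c : R := m.+1%:R^-1.
have c0 : 0 < c by rewrite invr_gt0.
have [|||||xi xi_design xiE] := @finite_design_exists _ _ mI q (fun=> c) x0 c => //.
- by move=> *; exact: ltW.
- exact: ltW.
- rewrite big_const_seq count_predT szq iter_addr_0 -mulrSr -mulr_natl.
  by rewrite divff// pnatr_eq0.
have [theta] := Hattained _ xi_design.
rewrite /discrepancy xiE; [|exact: mresidual|by move=> x; exact: sqr_ge0].
move=> thE; have := Delta0 _ xi_design; rewrite -thE lee_fin => le0.
have sq_ge0 x : 0 <= c * residual theta x ^+ 2.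
  by rewrite mulr_ge0 ?sqr_ge0 ?ltW.
have sum_ge0 : 0 <= \sum_(x <- q) c * residual theta x ^+ 2.
  by apply: sumr_ge0 => x _.
have res0 x : c * residual theta x ^+ 2 = 0 -> eta x = lincomb theta f x.
  by move/eqP; rewrite mulf_eq0 gt_eqF//= sqrf_eq0 subr_eq0 => /eqP.
have [a aE] := evaluation_from_nodes f_cheb x0 uq qI szq.
have -> : eta x0 = lincomb theta f x0.
  by apply: res0; apply/eqP; rewrite eq_le sq_ge0 andbT;
     apply: le_trans le0; rewrite lerDr.
rewrite !aE; apply: eq_big_seq => x xq; congr (_ * _).
rewrite th0// -res0//; apply/eqP.
have : \sum_(x <- q) c * residual theta x ^+ 2 = 0.
  apply/eqP; rewrite eq_le sum_ge0 andbT; apply: le_trans le0.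
  by rewrite lerDl; exact: sq_ge0.
by move/eqP; rewrite psumr_eq0// => /allP/(_ x xq).
Qed.

End Optimality.

Lemma card_ge_seq (T : choiceType) (A : set T) (s : seq T) (n : nat) :
  uniq s -> (n <= size s)%N -> [set` s] `<=` A -> (`I_n #<= A)%card.
Proof.
move=> us ns sA.
case: s us ns sA => [|x0 s] us ns sA.
  by move: ns; rewrite leqn0 => /eqP ->; rewrite II0 card_ge0.
apply: (@card_le_trans _ _ _ [set` x0 :: s]); last exact: subset_card_le.
apply: (@card_le_trans _ _ _ (nth x0 (x0 :: s) @` `I_n)).
  rewrite (card_le_eqr (inj_card_eq _)) ?card_lexx// => i j; rewrite !inE/= => im jm.
  by move/eqP; rewrite nth_uniq ?(leq_trans im) ?(leq_trans jm)// => /eqP.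
by apply: subset_card_le => _ [i /= im <-]; rewrite mem_nth// (leq_trans im).
Qed.

(** * The dual vector of the explicit design *)

Section ExplicitDesign.
Variables (R : realType) (I : set R) (m : nat).
Variables (f : 'I_m -> R -> R) (eta : R -> R).
Hypothesis f_cheb : chebyshev_system I f.
Hypothesis ext_cheb : chebyshev_system I (extend_family f eta).
Variable x : 'I_m.+1 -> R.
Hypothesis x_incr : increasing_points I x.

Let X := design_matrix f eta x.
Let u := u_vec f eta x.
Let U := \sum_j `|u j 0|.

Let X_unit : X \in unitmx.
Proof.
have [eps _ /(_ x x_incr)] := ext_cheb.
rewrite unitmxE unitfE; apply: contraTneq => X0.
by rewrite -/(design_matrix f eta x) -/X X0 mulr0 ltxx.
Qed.

(* The square matrix X is invertible, so the normal equations that define u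
reduce to X u = e. *)
Let uE : u = invmx X *m delta_mx ord_max 0.
Proof.
have XT_unit : X^T \in unitmx by rewrite unitmx_tr.
apply: (can_inj (mulKmx X_unit)); apply: (can_inj (mulKmx XT_unit)).
rewrite mulKVmx// mulmxA /u /u_vec -/X -[X in _ *m X]mulmxA mulKVmx//.
by rewrite unitmx_mul XT_unit.
Qed.

Lemma extend_family_lift i : extend_family f eta (lift ord_max i) = f i.
Proof. by rewrite /extend_family liftK. Qed.

Lemma extend_family_max : extend_family f eta ord_max = eta.
Proof. by rewrite /extend_family unlift_none. Qed.

Lemma lincomb_extend (c : 'cV[R]_m.+1) (y : R) :
  lincomb c (extend_family f eta) y =
  lincomb (\col_i c (lift ord_max i) 0) f y + c ord_max 0 * eta y.
Proof.
rewrite /lincomb big_ord_recr/= extend_family_max; congr (_ + _).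
apply: eq_bigr => i _; rewrite mxE.
have -> : widen_ord (leqnSn m) i = lift ord_max i by apply: val_inj; exact: esym (lift_max i).
by rewrite extend_family_lift.
Qed.

(** The weights [u] annihilate [f] and give mass one to [eta]: they read off the
coefficient of [eta]. *)
Lemma u_vec_dual (c : 'cV[R]_m.+1) :
  \sum_j u j 0 * lincomb c (extend_family f eta) (x j) = c ord_max 0.
Proof.
under eq_bigr do rewrite mulr_sumr.
rewrite exchange_big/=.
transitivity (\sum_i c i 0 * (X *m u) i 0).
  apply: eq_bigr => i _; rewrite mxE mulr_sumr; apply: eq_bigr => j _.
  have -> : X i j = extend_family f eta i (x j) by exact: mxE.
  by ring.
rewrite uE mulKVmx// (bigD1 ord_max)//= big1 => [|i /negPf im].
  by rewrite mxE !eqxx mulr1 addr0.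
by rewrite mxE im mulr0.
Qed.

(** By Cramer's rule [u j] is, up to a common factor and the sign [(-1) ^+ j], the
determinant of [f] at the points other than [x j], and these determinants have
the same sign because [f] is a Chebyshev system. *)
Lemma u_vec_alternates :
  exists2 sigma : R, `|sigma| = 1 &
    forall j, u j 0 * (-1) ^+ j = sigma * `|u j 0|.
Proof.
have [eps eps1 f_det] := f_cheb.
have detX : \det X != 0 by rewrite -unitfE -unitmxE.
have eps0 : eps != 0 by case: eps1 => ->; rewrite ?oppr_eq0 oner_eq0.
have epsV : eps * eps = 1 by case: eps1 => ->; ring.
pose D (j : 'I_m.+1) := \det (\matrix_(i < m, k < m) f i (x (lift j k))).
have D_gt0 j : 0 < eps * D j.
  apply: f_det; split=> [k|k l kl]; first by have [xI _] := x_incr.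
  have [_ xlt] := x_incr; apply: xlt => /=.
  by rewrite /bump; case: (leqP j k); case: (leqP j l) => ? ?; lia.
pose k : R := (\det X)^-1 * (-1) ^+ m * eps.
have k0 : k != 0 by rewrite !mulf_neq0 ?invr_eq0 ?signr_eq0.
have uD j : u j 0 * (-1) ^+ j = k * (eps * D j).
  rewrite uE /invmx X_unit -scalemxAl mxE -colE mxE mxE /cofactor/=.
  have -> : row' ord_max (col' j X) = \matrix_(i < m, k < m) f i (x (lift j k)).
    by apply/matrixP => a b; rewrite !mxE extend_family_lift.
  rewrite -/(D j) /k exprD.
  have : (-1) ^+ j * (-1) ^+ j = 1 :> R by rewrite -expr2 sqrr_sign.
  move: ((-1) ^+ j) => e ee.
  transitivity ((\det X)^-1 * (-1) ^+ m * D j * (e * e)); first by ring.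
  transitivity ((\det X)^-1 * (-1) ^+ m * D j * (eps * eps)); last by ring.
  by rewrite ee epsV.
exists (Num.sg k); first by rewrite normr_sg k0.
move=> j; rewrite uD.
have -> : `|u j 0| = `|k| * (eps * D j).
  by rewrite -[in RHS](gtr0_norm (D_gt0 j)) -normrM -uD normrM normrX normrN1 expr1n mulr1.
by rewrite [RHS]mulrA -numEsg.
Qed.

(** The values of the polynomial and the entries of [u] alternate together, so
the pairing that reads off the coefficient of [eta] adds up the [`|u j|] without
cancellation. *)
Lemma alternating_leading_coef (c : 'cV[R]_m.+1) :
  alternates_at I (extend_family f eta) c x -> `|c ord_max 0| = U.
Proof.
move=> [_ cx]; have [sigma sigma1 su] := u_vec_alternates.
rewrite -u_vec_dual.
under eq_bigr do rewrite cx exprS mulrCA su mulrCA.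
rewrite -mulr_sumr -[X in _ * X]mulr_sumr.
by rewrite !normrM sigma1 normrN1 !mul1r ger0_norm ?sumr_ge0.
Qed.

End ExplicitDesign.

(** * The theorem *)

(* If Delta xi0 = 0 then eta is in the span of f on I, minimizers may be
   non-unique and the extremal set may depend on the choice of minimizer; only
   in that case is it required that xi0 determine the extremal set. *)
Theorem theorem3p3 (R : realType) (I : set R) (m : nat)
    (eta : R -> R) (f : 'I_m -> R -> R)
    (HI : is_interval I)
    (HI_nondegenerate : exists a b : R, [/\ I a, I b & a < b])
    (Heta : {within I, continuous eta})
    (Hf : forall i : 'I_m, {within I, continuous (f i)})
    (Hattained : forall xi : {measure set (measurableTypeR R) -> \bar R},
       is_design I xi ->
       exists theta : 'cV[R]_m, discrepancy I eta f xi theta = Delta I eta f xi)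
    (Hexists : exists xi : {measure set (measurableTypeR R) -> \bar R},
       T_optimal I eta f xi)
    (Hcheb : chebyshev_system I f) :
  (forall (xi0 : {measure set (measurableTypeR R) -> \bar R})
          (theta_s : 'cV[R]_m),
     T_optimal I eta f xi0 ->
     is_minimizer I eta f xi0 theta_s ->
     (Delta I eta f xi0 = 0%E ->
        forall theta : 'cV[R]_m, is_minimizer I eta f xi0 theta ->
          extremal_set I eta f theta = extremal_set I eta f theta_s) ->
     (`I_m.+1 #<= extremal_set I eta f theta_s)%card)
  /\
  (chebyshev_system I (extend_family f eta) ->
   (forall x : 'I_m -> R, increasing_points I x ->
      \det (bordered_matrix f eta x) != 0) ->
   forall x : 'I_m.+1 -> R,
     chebyshev_points I (extend_family f eta) x ->
     T_optimal I eta f (xi_star f eta x)).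
Proof.
have mI := is_interval_measurable HI.
have mres theta : measurable_fun I (fun x => (eta x - lincomb theta f x) ^+ 2).
  exact: measurable_sq_residual.
have disc_sum xi : is_design I xi -> exists s : seq R, exists w : R -> R,
    [/\ uniq s, forall x, x \in s -> I x, forall x, x \in s -> 0 < w x,
        \sum_(x <- s) w x = 1 &
        forall theta, discrepancy I eta f xi theta =
          (\sum_(x <- s) w x * (eta x - lincomb theta f x) ^+ 2)%:E].
  move=> /(integral_design mI)[s [w [us sI w_gt0 w1 sE]]].
  exists s, w; split => // theta.
  by rewrite /discrepancy sE; [|exact: mres|move=> x; exact: sqr_ge0].
split=> [xi0 theta_s xi0_opt theta_min extremal_indep|ext_cheb _ x].
  have [s [w [us sI w_gt0 w1 discE]]] := disc_sum _ xi0_opt.1.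
  (* With at most m support points eta is interpolated on the support, so the
  criterion vanishes and eta is represented on I by theta0; for theta0 every
  point of I is extremal, and here theta0 and theta_s share their extremal
  sets. *)
  have [sm|ms] := leqP (size s) m.
    have [theta1 th1] := interpolation HI HI_nondegenerate Hcheb eta us sI sm.
    have Delta0 : Delta I eta f xi0 = 0%E.
      apply/eqP; rewrite eq_le Delta_ge0 andbT (le_trans (Delta_le _ _ _ _ theta1))//.
      rewrite discE lee_fin big_seq big1// => y ys.
      by rewrite th1// subrr expr0n mulr0.
    have [theta0 th0] : exists theta, forall y, I y -> eta y - lincomb theta f y = 0.
      apply: (vanishing_Delta_span HI HI_nondegenerate) => // xi xi_design.
      by rewrite -Delta0; exact: xi0_opt.2.
    have theta0_min : is_minimizer I eta f xi0 theta0.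
      move=> theta; apply: le_trans (Delta_le _ _ _ _ theta).
      rewrite Delta0 discE lee_fin big_seq big1// => y ys.
      by rewrite th0 ?expr0n ?mulr0//; exact: sI.
    rewrite -(extremal_indep Delta0 _ theta0_min).
    have [q [uq qI szq]] := exists_points HI HI_nondegenerate m.+1.
    apply: (card_ge_seq uq); first by rewrite szq.
    move=> y /= /qI Iy; split=> //; apply/eqP; rewrite eq_le; apply/andP; split.
      apply: le_ereal_sup_tmp; exists `|eta y - lincomb theta0 f y|%:E => //.
      by exists y.
    by apply/ereal_supP => _ [z Iz <-]; rewrite !th0.
  apply: (card_ge_seq us ms); apply: (support_extremal sI w_gt0 w1) => x0.
  exact: (optimal_residual_le HI _ _ Hcheb xi0_opt theta_min us sI w_gt0 w1 discE (ltnW ms)).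
move=> [c [c_le1 _] c_alt]; have [x_incr _] := c_alt.
have [xI _] := x_incr.
pose U := \sum_j `|u_vec f eta x j 0|.
have cU : `|c ord_max 0| = U by exact: alternating_leading_coef c_alt.
have dual theta :
    \sum_j u_vec f eta x j 0 * (eta (x j) - lincomb theta f (x j)) = 1.
  (* The coefficients of eta - theta^T f in the extended family. *)
  pose d : 'cV[R]_m.+1 := \col_i (if unlift ord_max i is Some k then - theta k 0 else 1).
  have dE y : lincomb d (extend_family f eta) y = eta y - lincomb theta f y.
    rewrite lincomb_extend mxE unlift_none mul1r addrC.
    congr (_ + _); rewrite -sumrN; apply: eq_bigr => i _.
    by rewrite !mxE liftK mulNr.
  under eq_bigr do rewrite -dE.
  by rewrite (u_vec_dual ext_cheb x_incr) mxE unlift_none.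
have U0 : 0 < U := sum_norm_gt0 (dual 0).
have c0 : c ord_max 0 != 0 by rewrite -normr_eq0 cU gt_eqF.
have starE : xi_star f eta x =
    discrete_measure x (fun i => NngNum (weight_ge0 f eta x i)) by [].
have lower : ((U ^- 2)%:E <= Delta I eta f (xi_star f eta x))%E.
  apply: Delta_ge => theta.
  rewrite /discrepancy starE integral_discrete_measure//.
    by rewrite lee_fin; apply: weighted_sqr_ge; exact: dual.
  by move=> y; exact: sqr_ge0.
split.
  rewrite starE; apply: discrete_measure_is_design => //.
  by rewrite /= /weight -mulr_suml divff// gt_eqF.
move=> xi /disc_sum[s [w [us sI w_gt0 w1 discE]]].
apply: le_trans lower.
(* The parameter for which the residual is the Chebyshev polynomial divided by
its coefficient of eta. *)
pose theta := - (c ord_max 0)^-1 *: \col_i c (lift ord_max i) 0.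
apply: le_trans (Delta_le _ _ _ _ theta) _; rewrite discE lee_fin.
rewrite -[leRHS]mul1r -w1 mulr_suml big_seq [leRHS]big_seq; apply: ler_sum => y ys.
apply: ler_wpM2l; first by apply: ltW; exact: w_gt0.
have -> : eta y - lincomb theta f y =
    lincomb c (extend_family f eta) y / c ord_max 0.
  by rewrite lincombZ lincomb_extend; field.
rewrite -real_normK ?num_real// normrM normfV cU exprMn exprVn.
apply: ler_piMl; first by rewrite invr_ge0 exprn_ge0// ltW.
by apply: exprn_ile1 => //; apply: c_le1; exact: sI.
Qed.
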